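(* Let $f,h:\mathbb{R}^N\to\mathbb{R}$ be smooth functions. Assume $\nabla h$ never vanishes over the manifold $\{h=0\}$, and consider the vector field $$\Psi(\mathbf{x})=-h(\mathbf{x})\nabla h(\mathbf{x})-\nabla f(\mathbf{x})\left(\mathbf{1}-\frac{\nabla h(\mathbf{x})}{|\nabla h(\mathbf{x})|}\otimes\frac{\nabla h(\mathbf{x})}{|\nabla h(\mathbf{x})|}\right),$$ which is smooth in a neighbourhood $U$ of the manifold $\{h=0\}$ (on which $\nabla h\neq\mathbf{0}$). Suppose that local solutions of the problem $$\text{Minimize in }\mathbf{x}\in\mathbb{R}^N:\quad f(\mathbf{x})\quad\text{subject to}\quad h(\mathbf{x})=0$$ are isolated. Then the asymptotically stable equilibria of $\Psi$ (that is, of $\mathbf{x}'=\Psi(\mathbf{x})$) in $U$ are precisely the local solutions (local minima) of this problem.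
   Context: Gradients are row vectors ($1\times N$ matrices), $\mathbf{1}$ is the $N\times N$ identity matrix, and $\mathbf{a}\otimes\mathbf{b}=\mathbf{a}^T\mathbf{b}$ is the rank-one matrix given by the tensor product of two (row) vectors of $\mathbb{R}^N$. A local solution of the problem is a local minimum of $f$ relative to $\{h=0\}$. Standing assumption: the equilibria of the dynamical system $\mathbf{x}'=\Psi(\mathbf{x})$ are isolated. *)

(* Defs.v *)
From HB Require Import structures.
From mathcomp Require Import all_boot all_order all_algebra.
From mathcomp Require Import all_classical all_reals all_analysis.

Set Implicit Arguments.
Unset Strict Implicit.
Unset Printing Implicit Defensive.

Import Order.TTheory GRing.Theory Num.Theory.
Import numFieldNormedType.Exports.

Local Open Scope classical_set_scope.
Local Open Scope ring_scope.

Section Calculus.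
Context {R : realType} {N : nat}.
Implicit Types (f h : 'rV[R]_N -> R) (x v : 'rV[R]_N).

Definition partial (j : 'I_N) f x : R := 'D_(delta_mx 0 j) f x.

Definition grad f x : 'rV[R]_N := \row_j partial j f x.

Fixpoint Cn (k : nat) f : Prop :=
  if k is k'.+1 then
    (forall x, differentiable f x) /\ (forall j, Cn k' (partial j f))
  else continuous f.

Definition smooth f : Prop := forall k, Cn k f.

(* The library norm on matrices is the sup norm; only the topology it induces
   is used below, and lengths of gradients are measured by [enorm]. *)
Definition enorm v : R := Num.sqrt (\sum_j v 0 j ^+ 2).

Definition tensor (a b : 'rV[R]_N) : 'M[R]_N := a^T *m b.

Definition unit_normal h x : 'rV[R]_N := (enorm (grad h x))^-1 *: grad h x.

(* Meaningful only where the gradient of [h] does not vanish. *)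
Definition Psi f h x : 'rV[R]_N :=
  - (h x *: grad h x)
  - grad f x *m (1%:M - tensor (unit_normal h x) (unit_normal h x)).

Definition local_solution f h x : Prop :=
  h x = 0 /\ \forall y \near x, h y = 0 -> f x <= f y.

End Calculus.

Section Dynamics.
Context {R : realType} {N : nat}.
Variables (U : set 'rV[R]_N) (F : 'rV[R]_N -> 'rV[R]_N).
Implicit Types (x y : 'rV[R]_N) (T : \bar R) (gamma : R -> 'rV[R]_N).

(* [gamma] solves x' = F(x) in the phase space [U] on [0, T[, where [T] may be
   +oo; the values of [gamma] outside [0, T[ are irrelevant. Continuity at 0
   and the equation on ]0, T[ give the one-sided equation at 0 whenever [F] is
   continuous on [U]. *)
Definition solution T gamma : Prop :=
  [/\ {within [set t : R | 0 <= t /\ (t%:E < T)%E], continuous gamma},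
      forall t : R, 0 <= t -> (t%:E < T)%E -> U (gamma t) &
      forall t : R, 0 < t -> (t%:E < T)%E -> is_derive t 1 gamma (F (gamma t))].

Definition equilibrium x : Prop := U x /\ F x = 0.

Definition stable x : Prop :=
  forall V, nbhs x V -> \forall y \near x, forall T gamma,
    solution T gamma -> gamma 0 = y ->
    forall t : R, 0 <= t -> (t%:E < T)%E -> V (gamma t).

(* Solutions starting near [x] exist for all positive times and tend to [x]. *)
Definition attractive x : Prop :=
  \forall y \near x,
    (exists2 gamma, solution +oo%E gamma & gamma 0 = y) /\
    (forall gamma, solution +oo%E gamma -> gamma 0 = y ->
       gamma t @[t --> +oo] --> x).

Definition asymptotically_stable_equilibrium x : Prop :=
  [/\ equilibrium x, stable x & attractive x].

End Dynamics.

(* Main.v *)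
Require Import Defs.
From HB Require Import structures.
From mathcomp Require Import all_boot all_order all_algebra.
From mathcomp Require Import all_classical all_reals all_analysis.
From mathcomp Require Import ring lra.

Set Implicit Arguments.
Unset Strict Implicit.
Unset Printing Implicit Defensive.

Import Order.TTheory GRing.Theory Num.Theory.
Import numFieldNormedType.Exports.

Local Open Scope classical_set_scope.
Local Open Scope ring_scope.

(** Write g for the gradient of h and w for the part of the gradient of f that
    is orthogonal to g, so that the field is - h g - w. Along a trajectory
    h' = - |g|^2 h, hence h keeps its sign, {h = 0} is invariant, and on
    {h = 0} the objective decreases: f' = - |w|^2.

    An asymptotically stable equilibrium x satisfies h x = 0, and every nearby
    y with h y = 0 flows to x inside {h = 0} without increasing f, so that
    f x <= f y ([asymptotically_stable_local_solution]).

    Conversely, f itself need not be monotone off {h = 0}, but the exact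
    penalty L = f - f x + K |h| is a strict Lyapunov function for K large.
    Isolatedness makes a local solution x a strict one
    ([strict_local_solution]); a point y close to x is at distance O(|h y|)
    from {h = 0} ([near_level_projection]), and f is Lipschitz, so L > 0 near x
    away from x ([exact_penalty]). Differentiating L >= 0 at x in the direction
    - w yields w = 0 at x, which is the Lagrange condition
    ([lagrange_condition]): x is an equilibrium. Along trajectories
    L' = - (h <grad f, g> + K |h| |g|^2 + |w|^2); for K large this is negative
    wherever h <> 0 or w <> 0, that is, near x, at every point but x, because
    equilibria are isolated ([penalty_decrease],
    [local_solution_asymptotically_stable]).

    It remains to prove Lyapunov's theorem
    ([lyapunov_asymptotically_stable]). Attractivity includes the existence of
    solutions for all positive times: the field is made bounded and globally
    Lipschitz by composing it with the retraction onto a closed ball, Picard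
    iteration solves the modified equation on the whole half-line
    ([global_solution]), and the Lyapunov function keeps the solution in the
    ball, where the field has not been modified. *)

(** * Derivative estimates on the real line *)

Section RealLine.
Context {R : realType}.
Implicit Types (u v du dv : R -> R) (a b : R).

Lemma is_derive_increment_le u du a b k : a <= b ->
  {within `[a, b], continuous u} ->
  (forall t, a < t < b -> is_derive t 1 u (du t)) ->
  (forall t, a < t < b -> du t <= k) ->
  u b <= u a + k * (b - a).
Proof.
rewrite le_eqVlt => /predU1P[<- _ _ _|ab cu du_u duk].
  by rewrite subrr mulr0 addr0.
have [c cab ucE] : exists2 c, c \in `]a, b[%R & u b - u a = du c * (b - a).
  by apply: MVT => // x; rewrite in_itv/=; exact: du_u.
rewrite -lerBlDl ucE ler_wpM2r ?subr_ge0 ?(ltW ab)//.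
by apply: duk; rewrite in_itv/= in cab.
Qed.

Lemma is_derive_norm_le u v du dv a b : a <= b ->
  {within `[a, b], continuous u} -> {within `[a, b], continuous v} ->
  (forall t, a < t < b -> is_derive t 1 u (du t)) ->
  (forall t, a < t < b -> is_derive t 1 v (dv t)) ->
  (forall t, a < t < b -> `|du t| <= dv t) ->
  `|u a| <= v a -> `|u b| <= v b.
Proof.
move=> ab cu cv du_u dv_v duv; rewrite !ler_norml => /andP[uva1 uva2].
have duvP t : a < t < b -> - dv t <= du t <= dv t.
  by move=> /duv; rewrite ler_norml.
have h1 : (u - v) b <= (u - v) a + 0 * (b - a).
  apply: (@is_derive_increment_le (u - v) (fun t => du t - dv t)) => //.
  - exact: within_continuousB.
  - by move=> t tab; apply: is_deriveB; [exact: du_u|exact: dv_v].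
  - by move=> t /duvP /andP[? ?]; lra.
have h2 : (- (u + v)) b <= (- (u + v)) a + 0 * (b - a).
  apply: (@is_derive_increment_le _ (fun t => - (du t + dv t))) => //.
  - by move=> t; apply: cvgN; apply: cvgD; [exact: cu|exact: cv].
  - move=> t tab; apply: is_deriveN; apply: is_deriveD;
    [exact: du_u|exact: dv_v].
  - by move=> t /duvP /andP[? ?]; lra.
move: h1 h2; rewrite !fctE => h1 h2.
by apply/andP; split; lra.
Qed.

(** The integral is taken from -1, so that the fundamental theorem of calculus
    also gives continuity at 0; freezing the result on the negative half-line
    makes it continuous everywhere. *)
Lemma antiderivative u : continuous u ->
  exists v, [/\ continuous v, v 0 = 0 &
    forall t : R, 0 < t -> is_derive t 1 v (u t)].
Proof.
move=> cu; pose w (x : R) : R :=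
  (\int[@lebesgue_measure R]_(t in [set` `[(-1), x]]) (u t))%R.
have dw (x : R) : -1 < x -> is_derive x 1 w (u x).
  move=> x1.
  have [| |dwx wx] := @continuous_FTC1_closed R u (-1) x (x + 1) _ _ x1 (cu x).
  - by rewrite ltrDl.
  - apply: continuous_compact_integrable; first exact: segment_compact.
    exact: continuous_subspaceT.
  - by apply: DeriveDef; [exact: dwx|rewrite -derive1E; exact: wx].
pose m (t : R) := Num.max 0 t.
have cm : continuous m.
  by move=> t; apply: continuous_max; [exact: cst_continuous|exact: cvg_id].
exists (fun t => w (m t) - w 0); split.
- move=> t; apply: cvgB; last exact: cvg_cst.
  apply: (continuous_comp (cm t)); apply: differentiable_continuous.
  apply/derivable1_diffP; have /dw[] // : -1 < m t.
  by rewrite (@lt_le_trans _ _ 0)// /m le_max lexx.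
- by rewrite /m maxxx subrr.
- move=> t t0; apply: (@near_eq_is_derive _ _ _ (fun t => w t - w 0)).
    near=> s; congr (w _ - _); rewrite /m; apply/esym/max_r/ltW.
    by near: s; exact: lt_nbhsr.
  rewrite -[u t]subr0; apply: is_deriveB.
  by apply: dw; rewrite (lt_trans _ t0).
Unshelve. all: by end_near. Qed.

(** The intervals of radius 2 C / 2^n around u n are nested, so that the
    supremum of their left ends lies in all of them. *)
Lemma geometric_limit (u : nat -> R) (C : R) : 0 <= C ->
  (forall n, `|u n.+1 - u n| <= C * 2^-1 ^+ n) ->
  exists l, forall n, `|u n - l| <= 2 * C * 2^-1 ^+ n.
Proof.
move=> C0 uC; pose c n : R := 2 * C * 2^-1 ^+ n.
have cS n : c n.+1 = c n - C * 2^-1 ^+ n.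
  by rewrite /c exprS; field.
have lo n k : u n - c n <= u (n + k)%N - c (n + k)%N.
  elim: k => [|k IH]; first by rewrite addn0.
  rewrite addnS cS; move: (uC (n + k)%N); rewrite ler_norml => /andP[? ?]; lra.
have up n k : u (n + k)%N + c (n + k)%N <= u n + c n.
  elim: k => [|k IH]; first by rewrite addn0.
  rewrite addnS cS; move: (uC (n + k)%N); rewrite ler_norml => /andP[? ?]; lra.
have c0 n : 0 <= c n by rewrite /c !mulr_ge0 ?exprn_ge0.
have lu n m : u n - c n <= u m + c m.
  have := lo n m; have := up m n; rewrite addnC; have := c0 (n + m)%N; lra.
pose A := [set u n - c n | n in [set: nat]].
have A0 : A !=set0 by exists (u 0%N - c 0%N), 0%N.
exists (sup A) => n; rewrite -/(c n) ler_norml.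
have h1 : u n - c n <= sup A.
  apply: ub_le_sup; last by exists n.
  by exists (u 0%N + c 0%N) => _ [k _ <-].
have h2 : sup A <= u n + c n by apply: ge_sup => // _ [k _ <-].
by apply/andP; split; lra.
Qed.

End RealLine.

(** * Curves of row vectors *)

Section Rows.
Context {R : realType} {N : nat}.
Implicit Types (v : 'rV[R]_N) (gamma : R -> 'rV[R]_N).

Lemma row_norm_ge v j : `|v 0 j| <= `|v|.
Proof.
rewrite [leRHS]/Num.Def.normr/= mx_normrE.
exact: (le_bigmax _ (fun i : 'I_1 * 'I_N => `|v i.1 i.2|) (0, j)).
Qed.

Lemma row_norm_le v c : 0 <= c -> (forall j, `|v 0 j| <= c) -> `|v| <= c.
Proof.
move=> c0 vc; rewrite /Num.Def.normr/= mx_normrE; apply: bigmax_le => //.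
by move=> [i j] _ /=; rewrite (ord1 i).
Qed.

Lemma cvg_row (T : Type) (F : set_system T) (FF : Filter F)
    (g : T -> 'rV[R]_N) v :
  (forall j, g t 0 j @[t --> F] --> v 0 j) -> g t @[t --> F] --> v.
Proof.
move=> gv; apply/cvgrPdist_le => e e0; near=> t.
apply: row_norm_le; first exact: ltW.
move=> j; rewrite !mxE; move: j; near: t; apply: filter_forall => j.
by have /cvgrPdist_le/(_ _ e0) := gv j.
Unshelve. all: by end_near. Qed.

Lemma is_derive_coord gamma (t : R) v j :
  is_derive t 1 gamma v -> is_derive t 1 (fun s => gamma s 0 j) (v 0 j).
Proof.
move=> [dg <-]; apply: DeriveDef; first by have /derivable_mxP := dg; apply.
by rewrite derive_mx// mxE.
Qed.

Lemma is_derive_row gamma (t : R) v :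
  (forall j, is_derive t 1 (fun s => gamma s 0 j) (v 0 j)) ->
  is_derive t 1 gamma v.
Proof.
move=> dg; have dg1 : derivable gamma t 1.
  by apply/derivable_mxP => i j; rewrite (ord1 i); have [] := dg j.
apply: DeriveDef => //; rewrite derive_mx//.
by apply/rowP => j; rewrite mxE; have [] := dg j.
Qed.

Lemma within_continuous_coord (A : set R) gamma j :
  {within A, continuous gamma} ->
  {within A, continuous (fun t => gamma t 0 j)}.
Proof.
move=> cg; apply: (@within_continuous_comp _ _ _ A gamma
  (fun v : 'rV[R]_N => v 0 j)) => //.
by move=> v _; exact: coord_continuous.
Qed.

Lemma is_derive_row_norm_le gamma dgamma (v dv : R -> R) a b : a <= b ->
  {within `[a, b], continuous gamma} -> {within `[a, b], continuous v} ->
  (forall t, a < t < b -> is_derive t 1 gamma (dgamma t)) ->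
  (forall t, a < t < b -> is_derive t 1 v (dv t)) ->
  (forall t, a < t < b -> `|dgamma t| <= dv t) ->
  0 <= v b -> `|gamma a| <= v a -> `|gamma b| <= v b.
Proof.
move=> ab cg cv dg dv_v dgdv vb0 gva; apply: row_norm_le => // j.
apply: (@is_derive_norm_le _ (fun t => gamma t 0 j) v
  (fun t => dgamma t 0 j) dv a) => //.
- exact: within_continuous_coord.
- by move=> t tab; apply: is_derive_coord; exact: dg.
- by move=> t tab; apply: le_trans (dgdv _ tab); exact: row_norm_ge.
- by apply: le_trans gva; exact: row_norm_ge.
Qed.

Lemma lipschitz_continuous (V W : normedModType R) (F : V -> W) k :
  (forall y z, `|F y - F z| <= k * `|y - z|) -> continuous F.
Proof.
move=> Fk y; apply/cvgrPdist_le => e e0; near=> z.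
apply: (le_trans (Fk _ _)); apply: (@le_trans _ _ ((`|k| + 1) * `|y - z|)).
  by rewrite ler_wpM2r// (le_trans (ler_norm k))// lerDl.
rewrite -ler_pdivlMl ?ltr_wpDl// mulrC; near: z.
apply: cvgr_dist_le => //.
by rewrite divr_gt0// ltr_wpDl.
Unshelve. all: by end_near. Qed.

End Rows.

(** * Global solutions of Lipschitz equations *)

Section Picard.
Context {R : realType} {N : nat}.
Variables (F : 'rV[R]_N -> 'rV[R]_N) (k B : R).
Hypothesis k0 : 0 < k.
Hypothesis F_lipschitz : forall y z, `|F y - F z| <= k * `|y - z|.
Hypothesis F_bounded : forall y, `|F y| <= B.

Let picard_step y gamma : continuous gamma ->
  exists Gamma, [/\ continuous Gamma, Gamma 0 = y &
    forall t : R, 0 < t -> is_derive t 1 Gamma (F (gamma t))].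
Proof.
move=> cgamma.
have /choice[G HG] (j : 'I_N) : exists v, [/\ continuous v, v 0 = 0 &
    forall t : R, 0 < t -> is_derive t 1 v (F (gamma t) 0 j)].
  apply: (antiderivative (u := fun t => F (gamma t) 0 j)) => t.
  apply: (@continuous_comp _ _ _ gamma (fun v => F v 0 j)); first exact: cgamma.
  apply: (@continuous_comp _ _ _ F (fun v : 'rV[R]_N => v 0 j)).
    exact: lipschitz_continuous F_lipschitz _.
  exact: coord_continuous.
exists (fun t => \row_j (y 0 j + G j t)); split.
- move=> t; apply: cvg_row => j; rewrite mxE.
  under eq_fun do rewrite mxE.
  apply: cvgD; first exact: cvg_cst.
  by have [cG _ _] := HG j; exact: cG.
- apply/rowP => j; rewrite !mxE.
  by have [_ -> _] := HG j; rewrite addr0.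
- move=> t t0; apply: is_derive_row => j; have [_ _ dG] := HG j.
  under eq_fun do rewrite mxE.
  by rewrite -[X in is_derive _ _ _ X]add0r; apply: is_deriveD; exact: dG.
Qed.

(** Picard iteration, measured with the weight exp (2 k t): since the
    derivative of this weight is 2 k times itself, integrating a k-Lipschitz
    function halves the weighted distance, and the iterates converge
    geometrically on the whole half-line at once. *)
Lemma global_solution y : exists gamma,
  [/\ continuous gamma, gamma 0 = y &
      forall t : R, 0 < t -> is_derive t 1 gamma (F (gamma t))].
Proof.
have B0 : 0 <= B by exact: le_trans (F_bounded y).
have /choice[Phi HPhi] (gamma : R -> 'rV[R]_N) : exists Gamma,
    continuous gamma -> [/\ continuous Gamma, Gamma 0 = y &
    forall t : R, 0 < t -> is_derive t 1 Gamma (F (gamma t))].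
  have [/(picard_step y)[G HG]|ng] := pselect (continuous gamma).
    by exists G.
  by exists gamma.
pose g n := iter n Phi (cst y).
have cg n : continuous (g n).
  elim: n => [|n IH]; first exact: cst_continuous.
  by have [] := HPhi _ IH.
have gS n : [/\ continuous (g n.+1), g n.+1 0 = y &
    forall t : R, 0 < t -> is_derive t 1 (g n.+1) (F (g n t))].
  exact: HPhi.
have g_0 : g 0%N = cst y by [].
clearbody g.
pose E (t : R) := expR (2 * k * t).
have E0 t : 0 <= E t by exact: expR_ge0.
have cE (c : R) : continuous (fun t => c * E t).
  move=> t; apply: cvgM; first exact: cvg_cst.
  apply: (@continuous_comp _ _ _ (fun t => 2 * k * t) expR).
    by apply: cvgM; [exact: cvg_cst|exact: cvg_id].
  exact: continuous_expR.
have dE (c t : R) : is_derive t 1 (fun t => c * E t) (c * (2 * k) * E t).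
  by apply: is_derive_eq; rewrite /E /GRing.scale/=; ring.
pose c n : R := B / (2 * k) * 2^-1 ^+ n.
have c0 n : 0 <= c n.
  by rewrite /c mulr_ge0 ?exprn_ge0// divr_ge0// mulr_ge0 ?ltW.
have cauchy n t : 0 <= t -> `|g n.+1 t - g n t| <= c n * E t.
  elim: n t => [|n IH] t t0.
    have [cg1 g10 dg1] := gS 0%N.
    apply: (@is_derive_row_norm_le _ _ (fun t => g 1%N t - g 0%N t)
      (fun t => F (g 0%N t) - 0) (fun t => c 0%N * E t)
      (fun t => c 0%N * (2 * k) * E t) 0) => //.
    - apply: continuous_subspaceT => s; apply: cvgB; [exact: cg|exact: cg].
    - exact: continuous_subspaceT.
    - move=> s /andP[s0 _]; rewrite g_0; apply: is_deriveB; rewrite -g_0.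
      exact: dg1.
    - move=> s /andP[s0 _]; rewrite subr0 (le_trans (F_bounded _))//.
      rewrite /c expr0 mulr1 divfK ?mulf_neq0 ?gt_eqF//.
      rewrite ler_peMr// /E (le_trans _ (expR_ge1Dx _))// lerDl.
      by rewrite !mulr_ge0 ?ltW.
    - by rewrite mulr_ge0.
    - by rewrite /= g10 g_0 subrr normr0 mulr_ge0.
  have [cg1 g10 dg1] := gS n.+1; have [cg2 g20 dg2] := gS n.
  apply: (@is_derive_row_norm_le _ _ (fun t => g n.+2 t - g n.+1 t)
    (fun t => F (g n.+1 t) - F (g n t)) _
    (fun t => c n.+1 * (2 * k) * E t) 0) => //.
  - apply: continuous_subspaceT => s; apply: cvgB; [exact: cg1|exact: cg2].
  - exact: continuous_subspaceT.
  - move=> s /andP[s0 _]; apply: is_deriveB; [exact: dg1|exact: dg2].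
  - move=> s /andP[s0 _]; rewrite (le_trans (F_lipschitz _ _))//.
    rewrite (_ : _ * E s = k * (c n * E s)).
      by rewrite ler_wpM2l ?(ltW k0)// IH// ltW.
    by rewrite /c exprS; field; rewrite gt_eqF.
  - by rewrite mulr_ge0.
  - by rewrite /= g10 g20 subrr normr0 mulr_ge0.
have /choice[l Hl] (t : R) : exists x : 'rV[R]_N, 0 <= t ->
    forall n, `|g n t - x| <= 2 * c n * E t.
  have [t0|] := leP 0 t; last by exists 0.
  have /choice[x Hx] (j : 'I_N) : exists x : R, forall n,
      `|g n t 0 j - x| <= 2 * (B / (2 * k) * E t) * 2^-1 ^+ n.
    apply: (geometric_limit (u := fun n => g n t 0 j)).
      by rewrite mulr_ge0// divr_ge0// mulr_ge0 ?ltW.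
    move=> n; rewrite mulrAC -/(c n); apply: le_trans (cauchy n t t0).
    by have := row_norm_ge (g n.+1 t - g n t) j; rewrite !mxE.
  exists (\row_j x j) => _ n; apply: row_norm_le.
    by rewrite mulr_ge0// mulr_ge0.
  move=> j; rewrite !mxE; apply: (le_trans (Hx j n)).
  by rewrite /c le_eqVlt; apply/orP; left; apply/eqP; ring.
have g_lip n s t : 0 <= s -> s <= t -> `|g n t - g n s| <= B * (t - s).
  move=> s0 st; case: n => [|n].
    by rewrite g_0 subrr normr0 mulr_ge0// subr_ge0.
  have [cg1 g10 dg1] := gS n.
  apply: (@is_derive_row_norm_le _ _ (fun t => g n.+1 t - g n.+1 s)
      (fun t => F (g n t) - 0) (fun t => B * (t - s)) (fun=> B) s) => //.
  - apply: continuous_subspaceT => r; apply: cvgB; [exact: cg1|exact: cvg_cst].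
  - apply: continuous_subspaceT => r; apply: cvgM; first exact: cvg_cst.
    by apply: cvgB; [exact: cvg_id|exact: cvg_cst].
  - move=> r /andP[sr _]; apply: is_deriveB; apply: dg1.
    exact: le_lt_trans sr.
  - by move=> r _; apply: is_derive_eq; rewrite /GRing.scale/=; ring.
  - by move=> r _; rewrite subr0.
  - by rewrite mulr_ge0// subr_ge0.
  - by rewrite !subrr normr0 mulr0.
have squeeze (a b d : R) : (forall n, a <= b + d * 2^-1 ^+ n) -> a <= b.
  move=> abd; have : (fun n => b + d * 2^-1 ^+ n) @ \oo --> b + d * 0.
    apply: cvgD; first exact: cvg_cst.
    apply: cvgM; first exact: cvg_cst.
    by apply: cvg_expr; rewrite ger0_norm//; lra.
  rewrite mulr0 addr0 => bd; rewrite -(cvg_lim _ bd)//.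
  by apply: limr_ge; [apply/cvg_ex; exists b|exact: nearW].
(* All iterates are B-Lipschitz, hence so is their pointwise limit l: this
   makes F o l continuous, so that one more Picard step applies to l. *)
have l_lip s t : 0 <= s -> s <= t -> `|l t - l s| <= B * (t - s).
  move=> s0 st; have t0 := le_trans s0 st.
  apply: (squeeze _ _ (2 * (B / (2 * k)) * (E t + E s))) => n.
  rewrite (_ : l t - l s =
    (g n t - g n s) + (l t - g n t) + (g n s - l s)); last first.
    by apply/rowP => j; rewrite !mxE; ring.
  rewrite (le_trans (ler_normD _ _))//.
  have := Hl s s0 n; have := Hl t t0 n; rewrite (distrC (g n t)).
  have := ler_normD (g n t - g n s) (l t - g n t); have := g_lip n s t s0 st.
  rewrite /c; lra.
pose m (t : R) := Num.max 0 t.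
have m0 t : 0 <= m t by rewrite /m le_max lexx.
have cl : continuous (l \o m).
  apply: (@lipschitz_continuous _ _ _ _ B) => s t /=.
  wlog st : s t / s <= t.
    move=> H; have [/H//|/ltW/H] := leP s t.
    by rewrite distrC (distrC t).
  rewrite distrC (distrC s) (ger0_norm (_ : 0 <= t - s)) ?subr_ge0//.
  have mst : m s <= m t by rewrite /m; case: (leP 0 s); case: (leP 0 t); lra.
  rewrite (le_trans (l_lip _ _ (m0 s) mst))// ler_wpM2l//.
  by rewrite /m; case: (leP 0 s); case: (leP 0 t); lra.
have [Gamma [cG G0 dG]] := picard_step y cl.
exists Gamma; split => // t t0.
(* Gamma is the Picard step of l, which lies as close to the next iterate as l
   lies to the current one; in the limit Gamma = l. *)
suff -> : Gamma t = (l \o m) t by exact: dG.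
have mt s : 0 <= s -> m s = s by move=> s0; rewrite /m max_r.
apply/eqP; rewrite -subr_eq0 -normr_le0 /= mt ?(ltW t0)//.
apply: (squeeze _ _ (2 * (B / (2 * k)) * E t)) => n.
have [cg1 g10 dg1] := gS n.
have Gg : `|Gamma t - g n.+1 t| <= c n * E t.
  apply: (@is_derive_row_norm_le _ _ (fun t => Gamma t - g n.+1 t)
    (fun t => F (l (m t)) - F (g n t)) _ (fun t => c n * (2 * k) * E t) 0) => //.
  - exact: ltW.
  - apply: continuous_subspaceT => s; apply: cvgB; [exact: cG|exact: cg1].
  - exact: continuous_subspaceT.
  - move=> s /andP[s0 _]; apply: is_deriveB; [exact: dG|exact: dg1].
  - move=> s /andP[/ltW s0 _]; rewrite (le_trans (F_lipschitz _ _))// mt//.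
    rewrite distrC (_ : _ * E s = k * (2 * c n * E s)); last by ring.
    by rewrite ler_wpM2l ?(ltW k0)// Hl.
  - by rewrite mulr_ge0.
  - by rewrite /= g10 G0 subrr normr0 mulr_ge0.
have := ler_distD (g n.+1 t) (Gamma t) (l t).
have := Hl t (ltW t0) n.+1; rewrite /c exprS in Gg *; lra.
Qed.

End Picard.

(** * Lyapunov's theorem *)

Section Clamp.
Context {R : realType} {N : nat}.
Implicit Types (x y z : 'rV[R]_N) (r : R).

(** The norm is the sup norm, so that its closed balls are cubes and clamping
    every coordinate is a 1-Lipschitz retraction onto the ball. *)
Definition clamp x r y : 'rV[R]_N :=
  \row_j Num.max (x 0 j - r) (Num.min (x 0 j + r) (y 0 j)).

Lemma clamp_ball x r y : 0 <= r -> `|clamp x r y - x| <= r.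
Proof.
move=> r0; apply: row_norm_le => // j; rewrite !mxE ler_norml.
by set a := x 0 j; case: (leP (a + r) (y 0 j)) => ?;
  case: (leP (a - r)) => *; apply/andP; split; lra.
Qed.

Lemma clamp_id x r y : `|y - x| <= r -> clamp x r y = y.
Proof.
move=> yxr; apply/rowP => j; have := le_trans (row_norm_ge (y - x) j) yxr.
rewrite !mxE ler_norml => /andP[yx1 yx2].
rewrite min_r; last by lra.
by rewrite max_r//; lra.
Qed.

Lemma clamp_lipschitz x r y z : `|clamp x r y - clamp x r z| <= `|y - z|.
Proof.
have scalar (a b s t : R) : s <= t -> 
    `|Num.max a (Num.min b s) - Num.max a (Num.min b t)| <= `|s - t|.
  move=> st; have [m1 m2] : Num.min b s <= Num.min b t /\
      Num.min b t <= Num.min b s + (t - s).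
    by case: (leP b s) => ?; case: (leP b t) => ?; split; lra.
  move: m1 m2; move: (Num.min b s) (Num.min b t) => u v uv vu.
  rewrite !(distrC _ (Num.max a v)) (distrC s).
  rewrite (ger0_norm (_ : 0 <= t - s)) ?subr_ge0//.
  by rewrite ler_norml; case: (leP a u) => ?; case: (leP a v) => ?;
    apply/andP; split; lra.
apply: row_norm_le => // j; have := row_norm_ge (y - z) j.
rewrite !mxE; apply: le_trans.
have [/scalar//|/ltW yz] := leP (y 0 j) (z 0 j).
by rewrite distrC (distrC (y 0 j)) scalar.
Qed.

End Clamp.

Lemma dist_continuous (R : realType) (V : normedModType R) (x : V) :
  continuous (fun y : V => `|y - x|).
Proof.
apply: (@lipschitz_continuous _ _ _ _ 1) => y z; rewrite mul1r.
by apply: (le_trans (ler_dist_dist _ _)); rewrite opprB addrA subrK.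
Qed.

Lemma norm_ball_compact (R : realType) (N : nat) (x : 'rV[R]_N) r :
  compact [set y | `|y - x| <= r].
Proof.
apply: bounded_closed_compact.
  exists (`|x| + r); split; first exact: num_real.
  move=> M xrM y /= yr; apply: le_trans (ltW xrM).
  by rewrite -[y](subrK x) (le_trans (ler_normD _ _))// addrC lerD2l.
rewrite (_ : mkset _ = (fun y => `|y - x|) @^-1` [set s | s <= r])//.
by apply: closed_comp; [move=> ? _; exact: dist_continuous|exact: closed_le].
Qed.

(** A first-exit principle: if g reached r, it would do so at a first time c,
    and up to c it would stay below r. *)
Lemma lt_until_exit (R : realType) (g : R -> R) r b : 0 <= b ->
  {within `[0, b], continuous g} -> g 0 < r ->
  (forall c, 0 <= c <= b -> (forall s, 0 <= s <= c -> g s <= r) -> g c != r) ->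
  g b < r.
Proof.
move=> b0 cg g0r exit; rewrite ltNge; apply/negP => rgb.
pose A := [set s | 0 <= s <= b /\ r <= g s].
have Ab : A b by split; rewrite ?b0 ?lexx.
have lbA : lbound A 0 by move=> s [/andP[]].
have hlA : has_lbound A by exists 0.
have hiA : has_inf A by split => //; exists b.
have c0 : 0 <= inf A by apply: lb_le_inf => //; exists b.
have cb : inf A <= b by apply: ge_inf.
have before s : 0 <= s < inf A -> g s < r.
  move=> /andP[s0 sc]; rewrite ltNge; apply/negP => rgs.
  have : inf A <= s.
    by apply: ge_inf => //; split=> //; rewrite s0 (le_trans (ltW sc)).
  by rewrite leNgt sc.
have rgc : r <= g (inf A).
  rewrite leNgt; apply/negP => gcr.
  have /subspace_continuousP/(_ (inf A)) := cg.
  rewrite /= in_itv/= c0 cb => /(_ isT)/cvgr_lt/(_ _ gcr).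
  rewrite near_withinE => /nbhs_ballP[e /= e0 eP].
  have [s [sb rgs] sce] := inf_adherent e0 hiA.
  have cs : inf A <= s by apply: ge_inf => //; split.
  suff: g s < r by rewrite ltNge rgs.
  apply: (eP s); last by rewrite /= in_itv.
  by rewrite /ball/= distrC ger0_norm ?subr_ge0// ltrBlDl.
have [s] : exists2 s, s \in `[0, inf A] & g s = r.
  apply: IVT => //.
    apply: continuous_subspaceW cg; apply: subset_itvl; by rewrite bnd_simp.
  by rewrite ge_min le_max (ltW g0r) rgc orbT.
rewrite in_itv/= => /andP[s0 sc] gsr.
have scE : s = inf A.
  apply/eqP; rewrite eq_le sc/= leNgt; apply/negP => sc'.
  by have := before s; rewrite s0 sc' gsr ltxx => /(_ isT).
have := exit (inf A); rewrite c0 cb -scE gsr eqxx => /(_ isT) H.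
suff: false by []; apply: H => u /andP[u0]; rewrite le_eqVlt => /predU1P[->|us].
  by rewrite gsr.
by apply/ltW/before; rewrite u0 -scE.
Qed.

Section Lyapunov.
Context {R : realType} {N : nat}.
Variables (U : set 'rV[R]_N) (F : 'rV[R]_N -> 'rV[R]_N) (x : 'rV[R]_N).
Variables (L D : 'rV[R]_N -> R) (r k : R).
Hypothesis r_gt0 : 0 < r.
Hypothesis ball_U : forall y : 'rV[R]_N, `|y - x| <= r -> U y.
Hypothesis F_lipschitz : forall y z : 'rV[R]_N, `|y - x| <= r -> `|z - x| <= r ->
  `|F y - F z| <= k * `|y - z|.
Hypothesis Fx : F x = 0.
Hypothesis L_continuous : continuous L.
Hypothesis Lx : L x = 0.
Hypothesis L_gt0 : forall y : 'rV[R]_N, `|y - x| <= r -> y <> x -> 0 < L y.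
Hypothesis D_continuous :
  {within [set y | `|y - x| <= r], continuous D}.
Hypothesis Dx : D x = 0.
Hypothesis D_gt0 : forall y : 'rV[R]_N, `|y - x| <= r -> y <> x -> 0 < D y.
(** The dissipation inequality L' <= - D along F, in integrated form, so that L
    may fail to be differentiable. *)
Hypothesis L_decrease : forall (gamma : R -> 'rV[R]_N) (a b d : R),
  a <= b ->
  {within `[a, b], continuous gamma} ->
  (forall t, a <= t <= b -> `|gamma t - x| <= r) ->
  (forall t, a < t < b -> is_derive t 1 gamma (F (gamma t))) ->
  (forall t, a <= t <= b -> d <= D (gamma t)) ->
  L (gamma b) <= L (gamma a) - d * (b - a).

Let D_ge0 y : `|y - x| <= r -> 0 <= D y.
Proof.
move=> yr; have [->|/eqP yx] := eqVneq y x; first by rewrite Dx.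
by rewrite ltW// D_gt0.
Qed.

(** The bound is attained by compactness. It is used for both L and D. *)
Let annulus_min (P : 'rV[R]_N -> R) rho : 0 < rho ->
  {within [set y | `|y - x| <= r], continuous P} ->
  (forall y : 'rV[R]_N, `|y - x| <= r -> y <> x -> 0 < P y) ->
  exists2 m, 0 < m & forall y : 'rV[R]_N, rho <= `|y - x| <= r -> m <= P y.
Proof.
move=> rho0 cP P0; pose A := [set y | rho <= `|y - x| <= r].
have [A0|/set0P A0] := eqVneq A set0.
  by exists 1 => // y yA; have : A y by []; rewrite A0.
have Ar : A `<=` [set y | `|y - x| <= r] by move=> y /= /andP[].
have cA : compact A.
  apply: subclosed_compact (@norm_ball_compact _ _ x r) Ar.
  rewrite (_ : A = (fun y => `|y - x|) @^-1` [set s | rho <= s] `&`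
     (fun y => `|y - x|) @^-1` [set s | s <= r]); last first.
    by apply/seteqP; split => y /=; [move=> /andP[]|move=> [? ?]; apply/andP].
  by apply: closedI; apply: closed_comp; [move=> ? _; exact: dist_continuous
    |exact: closed_ge|move=> ? _; exact: dist_continuous|exact: closed_le].
have [c] := EVT_min_rV A0 cA (continuous_subspaceW Ar cP).
rewrite inE => -[/andP[rc cr] cmin]; exists (P c).
  by apply: P0 => // cx; move: rc; rewrite cx subrr normr0 leNgt rho0.
by move=> y yA; apply: cmin; rewrite inE.
Qed.

Let L_within : {within [set y | `|y - x| <= r], continuous L}.
Proof. exact: continuous_subspaceT. Qed.

(** L does not increase as long as the curve is in the ball, so a curve that
    starts below the minimum m of L on the sphere of radius rho cannot cross
    that sphere. The curve is only required to follow F while it is in the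
    ball of radius r: this applies to solutions of the clamped equation. *)
Let trapped rho m (gamma : R -> 'rV[R]_N) (b : R) : 0 < rho -> rho <= r ->
  (forall y : 'rV[R]_N, `|y - x| = rho -> m <= L y) -> 0 <= b ->
  {within `[0, b], continuous gamma} -> `|gamma 0 - x| < rho ->
  L (gamma 0) < m ->
  (forall t, 0 < t < b -> `|gamma t - x| <= r ->
     is_derive t 1 gamma (F (gamma t))) ->
  `|gamma b - x| < rho.
Proof.
move=> rho0 rhor mL b0 cg g0 Lg0 dg.
apply: (@lt_until_exit _ (fun t => `|gamma t - x|)) => //.
  move=> t; apply: cvg_norm; apply: cvgB; [exact: cg|exact: cvg_cst].
move=> c /andP[c0 cb] gc; apply/eqP => gcrho.
have gr s : 0 <= s <= c -> `|gamma s - x| <= r.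
  by move=> /gc/le_trans; apply.
have : L (gamma c) <= L (gamma 0) - 0 * (c - 0).
  apply: L_decrease => //.
  - by apply: continuous_subspaceW cg; apply: subset_itvl; rewrite bnd_simp.
  - move=> t /andP[t0 tc]; apply: dg; first by rewrite t0 (lt_le_trans tc).
    by apply: gr; rewrite !ltW.
  - by move=> t tc; apply: D_ge0; exact: gr.
by have := mL _ gcrho; lra.
Qed.

Let solution_within T gamma (b : R) : solution U F T gamma ->
  (b%:E < T)%E -> {within `[0, b], continuous gamma}.
Proof.
move=> [cg _ _] bT; apply: continuous_subspaceW cg => s /=.
rewrite in_itv/= => /andP[-> sb]; split=> //.
by apply: le_lt_trans bT; rewrite lee_fin.
Qed.

Let stays rho m T gamma (t : R) : 0 < rho -> rho <= r ->
  (forall y : 'rV[R]_N, `|y - x| = rho -> m <= L y) -> solution U F T gamma ->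
  `|gamma 0 - x| < rho -> L (gamma 0) < m -> 0 <= t -> (t%:E < T)%E ->
  `|gamma t - x| < rho.
Proof.
move=> rho0 rhor mL sol g0 Lg0 t0 tT; apply: trapped Lg0 _ => //.
  exact: solution_within tT.
case: sol => _ _ dg s /andP[s0 st] _; apply: dg => //.
by apply: lt_trans tT; rewrite lte_fin.
Qed.

Let start_nbhs rho m : 0 < rho -> 0 < m ->
  \forall y \near x, `|y - x| < rho /\ L y < m.
Proof.
move=> rho0 m0; apply: filterI.
  by apply/nbhs_ballP; exists rho => // y; rewrite -ball_normE /= distrC.
have := L_continuous (x := x); rewrite /continuous_at Lx => /cvgr_lt; exact.
Qed.

(** Convergence: if L stayed above m' > 0 along a solution, the solution would
    stay away from x, where D is bounded below by some d > 0, and L would drop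
    below 0 in finite time. Hence L gets, and remains, smaller than its minimum
    outside any given neighbourhood of x. *)
Lemma lyapunov_asymptotically_stable : asymptotically_stable_equilibrium U F x.
Proof.
split.
- by split => //; apply: ball_U; rewrite subrr normr0 ltW.
- move=> V /nbhs_ballP[e /= e0 eV]; pose rho := Num.min e r.
  have rho0 : 0 < rho by rewrite lt_min e0 r_gt0.
  have rhor : rho <= r by rewrite ge_min lexx orbT.
  have [m m0 mL] := annulus_min rho0 L_within L_gt0.
  have := start_nbhs rho0 m0.
  apply: filterS => y [yrho Lym] T gamma sol g0 t t0 tT.
  apply: eV; rewrite -ball_normE /= distrC.
  rewrite (@lt_le_trans _ _ rho) ?ge_min ?lexx//.
  apply: (stays (m := m) rho0 rhor _ sol) tT; rewrite ?g0//.
  by move=> z zr; apply: mL; rewrite zr lexx.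
have [m m0 mL] := annulus_min r_gt0 L_within L_gt0.
have mLr y : `|y - x| = r -> m <= L y by move=> yr; apply: mL; rewrite yr lexx.
have := start_nbhs r_gt0 m0; apply: filterS => y [yr Lym]; split.
  pose k' := `|k| + 1; have k'0 : 0 < k' by rewrite ltr_wpDl.
  have F_lip u v : `|u - x| <= r -> `|v - x| <= r ->
      `|F u - F v| <= k' * `|u - v|.
    move=> ur vr; apply: (le_trans (F_lipschitz ur vr)); rewrite ler_wpM2r//.
    by rewrite (le_trans (ler_norm _))// lerDl.
  have cball z : `|clamp x r z - x| <= r by apply: clamp_ball; exact: ltW.
  have [||gamma [cg g0 dg]] :=
      @global_solution _ _ (F \o clamp x r) k' (k' * r) k'0 _ _ y.
  - move=> u v /=; apply: (le_trans (F_lip _ _ _ _)) => //.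
    by rewrite ler_wpM2l ?(ltW k'0)// clamp_lipschitz.
  - move=> u /=; rewrite -[F _]subr0 -Fx; apply: (le_trans (F_lip _ _ _ _)) => //.
      by rewrite subrr normr0 ltW.
    by rewrite ler_wpM2l ?(ltW k'0).
  have gr b : 0 <= b -> `|gamma b - x| < r.
    move=> b0; apply: (@trapped r m) => //; rewrite ?g0//.
      exact: continuous_subspaceT.
    by move=> t /andP[t0 tb] gtr; have := dg t t0; rewrite /= clamp_id.
  exists gamma => //; split.
  - exact: continuous_subspaceT.
  - by move=> t t0 _; apply: ball_U; rewrite ltW// gr.
  - move=> t t0 _; have := dg t t0; rewrite /= clamp_id//.
    by rewrite ltW// gr// ltW.
move=> gamma sol g0.
have gr t : 0 <= t -> `|gamma t - x| < r.
  by move=> t0; apply: (stays _ _ mLr sol); rewrite ?g0 ?ltry.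
have L_decr s t d : 0 <= s -> s <= t ->
    (forall u, s <= u <= t -> d <= D (gamma u)) ->
    L (gamma t) <= L (gamma s) - d * (t - s).
  move=> s0 st dD; apply: L_decrease => //.
  - apply: continuous_subspaceW (solution_within sol (ltry t)).
    by apply: subset_itvr; rewrite bnd_simp.
  - by move=> u /andP[su _]; rewrite ltW// gr// (le_trans s0).
  - case: sol => _ _ dg u /andP[su _]; apply: dg; rewrite ?ltry//.
    exact: le_lt_trans su.
apply/cvgrPdist_lt => e e0; pose rho := Num.min e r.
have rho0 : 0 < rho by rewrite lt_min e0 r_gt0.
have [m' m'0 mL'] := annulus_min rho0 L_within L_gt0.
have [T T0 LT] : exists2 T, 0 <= T & L (gamma T) < m'.
  apply: contrapT => noT.
  have Lm t : 0 <= t -> m' <= L (gamma t).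
    by move=> t0; rewrite leNgt; apply/negP => Lt; apply: noT; exists t.
  have /nbhs_ballP[rho2 /= rho20 rho2P] := start_nbhs r_gt0 m'0.
  have [d d0 dD] := annulus_min rho20 D_continuous D_gt0.
  (* At this time the decrease at rate d has used up L (gamma 0). *)
  pose t := L (gamma 0) / d.
  have t0 : 0 <= t by rewrite divr_ge0 ?(ltW d0)// (le_trans (ltW m'0))// Lm.
  have : L (gamma t) <= L (gamma 0) - d * (t - 0).
    apply: L_decr => // u /andP[u0 _]; apply: dD; rewrite (ltW (gr _ u0)) andbT.
    rewrite leNgt; apply/negP => gu.
    have [] : `|gamma u - x| < r /\ L (gamma u) < m'.
      by apply: rho2P; rewrite -ball_normE /= distrC.
    by move=> _; rewrite ltNge Lm.
  have -> : d * (t - 0) = L (gamma 0).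
    by rewrite subr0 /t mulrC divfK ?gt_eqF.
  rewrite subrr => Lt0.
  by have := Lm t t0; rewrite leNgt (le_lt_trans Lt0 m'0).
near=> t; have Tt : T <= t by near: t; exact: nbhs_pinfty_ge (num_real T).
have t0 := le_trans T0 Tt.
rewrite distrC (@lt_le_trans _ _ rho) ?ge_min ?lexx// ltNge; apply/negP => rhot.
have : L (gamma t) <= L (gamma T) - 0 * (t - T).
  apply: L_decr => // u /andP[Tu _]; apply: D_ge0.
  by rewrite ltW// gr// (le_trans T0).
have := mL' (gamma t); rewrite rhot (ltW (gr _ t0)) => /(_ isT); lra.
Unshelve. all: by end_near. Qed.

End Lyapunov.

(** * Gradients *)

Section Dot.
Context {R : realType} {N : nat}.
Implicit Types (u v w : 'rV[R]_N) (a : R).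

Definition dot u v : R := \sum_j u 0 j * v 0 j.

Lemma dotC u v : dot u v = dot v u.
Proof. by apply: eq_bigr => j _; rewrite mulrC. Qed.

Lemma dotDr u v w : dot u (v + w) = dot u v + dot u w.
Proof. by rewrite -big_split; apply: eq_bigr => j _; rewrite mxE mulrDr. Qed.

Lemma dotZr a u v : dot u (a *: v) = a * dot u v.
Proof. by rewrite big_distrr; apply: eq_bigr => j _; rewrite mxE /=; ring. Qed.

Lemma dotNr u v : dot u (- v) = - dot u v.
Proof. by rewrite -scaleN1r dotZr mulN1r. Qed.

Lemma dotDl u v w : dot (u + v) w = dot u w + dot v w.
Proof. by rewrite dotC dotDr !(dotC w). Qed.

Lemma dotZl a u v : dot (a *: u) v = a * dot u v.
Proof. by rewrite dotC dotZr dotC. Qed.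

Lemma dotNl u v : dot (- u) v = - dot u v.
Proof. by rewrite dotC dotNr dotC. Qed.

Lemma dot_ge0 v : 0 <= dot v v.
Proof. by apply: sumr_ge0 => j _; rewrite -expr2 sqr_ge0. Qed.

Lemma dot_eq0 v : (dot v v == 0) = (v == 0).
Proof.
apply/eqP/eqP => [v0|->]; last by rewrite -(scale0r 0) dotZr mul0r.
apply/rowP => j; rewrite mxE; apply/eqP; rewrite -sqrf_eq0 expr2.
have /psumr_eq0P/(_ v0)/(_ j isT)/eqP // :
  forall i : 'I_N, true -> 0 <= v 0 i * v 0 i.
by move=> i _; rewrite -expr2 sqr_ge0.
Qed.

Lemma dot_gt0 v : v <> 0 -> 0 < dot v v.
Proof. by move=> /eqP v0; rewrite lt0r dot_ge0 dot_eq0 v0. Qed.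

Lemma mulmx_tr_dot u v : u *m v^T = (dot u v)%:M.
Proof.
rewrite [LHS]mx11_scalar mxE; congr (_%:M).
by apply: eq_bigr => j _; rewrite mxE.
Qed.

Lemma enorm_sqr v : enorm v ^+ 2 = dot v v.
Proof.
have -> : dot v v = \sum_j v 0 j ^+ 2 by apply: eq_bigr => j _; rewrite expr2.
by rewrite /enorm sqr_sqrtr// sumr_ge0// => j _; rewrite sqr_ge0.
Qed.

End Dot.

Section Gradient.
Context {R : realType} {N : nat}.
Implicit Types (f h g : 'rV[R]_N -> R) (x y z v : 'rV[R]_N).

Lemma smooth_differentiable f x : smooth f -> differentiable f x.
Proof. by move=> sf; have [] := sf 1%N. Qed.

Lemma smooth_continuous f : smooth f -> continuous f.
Proof. by move=> sf; exact: (sf 0%N). Qed.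

Lemma smooth_partial f j : smooth f -> smooth (partial j f).
Proof. by move=> sf k; have [_ +] := sf k.+1; apply. Qed.

Lemma derive_grad f x v : differentiable f x -> 'D_v f x = dot (grad f x) v.
Proof.
move=> df; rewrite deriveE// [in LHS](row_sum_delta v) linear_sum.
apply: eq_bigr => j _; rewrite linearZ /= mxE /partial deriveE//.
by rewrite /GRing.scale /= mulrC.
Qed.

Lemma is_derive_along f (gamma : R -> 'rV[R]_N) (t : R) v :
  differentiable f (gamma t) -> is_derive t 1 gamma v ->
  is_derive t 1 (f \o gamma) (dot (grad f (gamma t)) v).
Proof.
move=> df [dg gv].
have dg' : differentiable gamma t by apply/derivable1_diffP.
have dfg : differentiable (f \o gamma) t by exact: differentiable_comp.
apply: DeriveDef; first exact: diff_derivable.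
rewrite deriveE// diff_comp// /=.
have -> : 'd gamma t 1 = v by rewrite -gv deriveE.
by rewrite -derive_grad// deriveE.
Qed.

Lemma is_derive_line x v (t : R) : is_derive t 1 (fun s : R => x + s *: v) v.
Proof.
apply: is_derive_row => j; under eq_fun do rewrite !mxE.
by apply: is_derive_eq; rewrite /GRing.scale /=; ring.
Qed.

Lemma line_continuous x v : continuous (fun s : R => x + s *: v).
Proof.
move=> t; apply: differentiable_continuous; apply/derivable1_diffP.
by have [] := is_derive_line x v t.
Qed.

End Gradient.

(** * Bounded Lipschitz functions on a ball *)

Section BoundedLipschitz.
Context {R : realType} {N : nat}.
Variables (x : 'rV[R]_N) (r : R).
Implicit Types (g : 'rV[R]_N -> R) (y z : 'rV[R]_N).

(** Boundedness and the Lipschitz property are carried together because neither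
    products nor inverses preserve the latter alone. *)
Definition bounded_lipschitz g := exists2 M, 0 <= M &
  forall y z, `|y - x| <= r -> `|z - x| <= r ->
  `|g y| <= M /\ `|g y - g z| <= M * `|y - z|.

Lemma eq_bounded_lipschitz g1 g2 : g1 =1 g2 ->
  bounded_lipschitz g1 -> bounded_lipschitz g2.
Proof. by move=> /funext ->. Qed.

Lemma bounded_lipschitz_cst (a : R) : bounded_lipschitz (fun=> a).
Proof.
exists `|a| => // y z _ _; split => //.
by rewrite subrr normr0 mulr_ge0.
Qed.

Lemma bounded_lipschitzD g1 g2 :
  bounded_lipschitz g1 -> bounded_lipschitz g2 ->
  bounded_lipschitz (fun y => g1 y + g2 y).
Proof.
move=> [M1 M10 gM1] [M2 M20 gM2]; exists (M1 + M2); first exact: addr_ge0.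
move=> y z yr zr; have [? ?] := gM1 _ _ yr zr; have [? ?] := gM2 _ _ yr zr.
split; first by rewrite (le_trans (ler_normD _ _))// lerD.
rewrite (_ : _ - _ = (g1 y - g1 z) + (g2 y - g2 z)); last by ring.
by rewrite (le_trans (ler_normD _ _))// mulrDl lerD.
Qed.

Lemma bounded_lipschitzM g1 g2 :
  bounded_lipschitz g1 -> bounded_lipschitz g2 ->
  bounded_lipschitz (fun y => g1 y * g2 y).
Proof.
move=> [M1 M10 gM1] [M2 M20 gM2]; exists (2 * (M1 * M2)).
  by rewrite !mulr_ge0.
move=> y z yr zr; have [g1y g1yz] := gM1 _ _ yr zr.
have [g2y g2yz] := gM2 _ _ yr zr; have [g2z _] := gM2 _ _ zr yr.
have M12 : 0 <= M1 * M2 by exact: mulr_ge0.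
split.
  have : `|g1 y| * `|g2 y| <= M1 * M2 by exact: ler_pM.
  by rewrite normrM; lra.
rewrite (_ : _ - _ = g1 y * (g2 y - g2 z) + (g1 y - g1 z) * g2 z); last by ring.
rewrite (le_trans (ler_normD _ _))// !normrM.
rewrite (_ : _ * `|y - z| = M1 * (M2 * `|y - z|) + (M1 * `|y - z|) * M2);
  last by ring.
by rewrite lerD// ler_pM.
Qed.

Lemma bounded_lipschitzN g :
  bounded_lipschitz g -> bounded_lipschitz (fun y => - g y).
Proof.
move=> gbl; apply: eq_bounded_lipschitz
  (bounded_lipschitzM (bounded_lipschitz_cst (- 1)) gbl).
by move=> y; rewrite mulN1r.
Qed.

Lemma bounded_lipschitz_norm g :
  bounded_lipschitz g -> bounded_lipschitz (fun y => `|g y|).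
Proof.
move=> [M M0 gM]; exists M => // y z yr zr; have [? ?] := gM _ _ yr zr.
by rewrite normr_id; split=> //; rewrite (le_trans (ler_dist_dist _ _)).
Qed.

Lemma bounded_lipschitzV g (c : R) : 0 < c ->
  (forall y, `|y - x| <= r -> c <= g y) ->
  bounded_lipschitz g -> bounded_lipschitz (fun y => (g y)^-1).
Proof.
move=> c0 gc [M M0 gM]; exists (c^-1 + M / (c * c)).
  by rewrite addr_ge0// ?invr_ge0 ?divr_ge0 ?mulr_ge0// ltW.
move=> y z yr zr; have [_ gyz] := gM _ _ yr zr.
have gy := gc _ yr; have gz := gc _ zr.
have gy0 := lt_le_trans c0 gy; have gz0 := lt_le_trans c0 gz.
have c_ge0 := ltW c0; have gyz0 : 0 < g y * g z by exact: mulr_gt0.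
split.
  rewrite ger0_norm ?invr_ge0 ?(ltW gy0)// (@le_trans _ _ c^-1)//.
    by rewrite lef_pV2.
  by rewrite lerDl divr_ge0// mulr_ge0.
have -> : (g y)^-1 - (g z)^-1 = (g z - g y) / (g y * g z).
  by field; rewrite !gt_eqF.
rewrite normrM normfV (ger0_norm (ltW gyz0)).
rewrite (@le_trans _ _ (M * `|y - z| / (c * c)))//.
  rewrite distrC ler_pM ?invr_ge0 ?(ltW gyz0)//.
  by rewrite lef_pV2 ?posrE ?mulr_gt0// ler_pM.
by rewrite (mulrAC M) ler_wpM2r// lerDr invr_ge0.
Qed.

Lemma bounded_lipschitz_sum n (g : 'I_n -> 'rV[R]_N -> R) :
  (forall i, bounded_lipschitz (g i)) ->
  bounded_lipschitz (fun y => \sum_i g i y).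
Proof.
elim: n g => [|n IH] g gbl.
  apply: eq_bounded_lipschitz (bounded_lipschitz_cst 0) => y.
  by rewrite big_ord0.
apply: eq_bounded_lipschitz (bounded_lipschitzD (gbl ord0)
  (IH (fun i => g (lift ord0 i)) (fun i => gbl _))) => y.
by rewrite big_ord_recl.
Qed.

Lemma bounded_lipschitz_dot (u v : 'rV[R]_N -> 'rV[R]_N) :
  (forall j, bounded_lipschitz (fun y => u y 0 j)) ->
  (forall j, bounded_lipschitz (fun y => v y 0 j)) ->
  bounded_lipschitz (fun y => dot (u y) (v y)).
Proof.
by move=> uj vj; apply: bounded_lipschitz_sum => j; exact: bounded_lipschitzM.
Qed.

Lemma bounded_lipschitz_row (u : 'rV[R]_N -> 'rV[R]_N) :
  (forall j, bounded_lipschitz (fun y => u y 0 j)) ->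
  exists k, forall y z, `|y - x| <= r -> `|z - x| <= r ->
    `|u y - u z| <= k * `|y - z|.
Proof.
move=> uj.
have /choice[M HM] j : exists M, 0 <= M /\ forall y z,
    `|y - x| <= r -> `|z - x| <= r -> `|u y 0 j - u z 0 j| <= M * `|y - z|.
  have [M M0 uM] := uj j; exists M; split=> // y z yr zr.
  by have [] := uM _ _ yr zr.
exists (\sum_j M j) => y z yr zr; apply: row_norm_le => [|j].
  by rewrite mulr_ge0// sumr_ge0// => j _; have [] := HM j.
have [_ /(_ y z yr zr)] := HM j; rewrite !mxE => /le_trans; apply.
rewrite ler_wpM2r// (bigD1 j)//= lerDl sumr_ge0// => i _.
by have [] := HM i.
Qed.

Lemma bounded_lipschitz_within_continuous g : bounded_lipschitz g ->
  {within [set y | `|y - x| <= r], continuous g}.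
Proof.
move=> [M M0 gM]; apply/subspace_continuousP => y /= yr.
apply/cvgrPdist_le => e e0; rewrite near_withinE; near=> z => /= zr.
have [_] := gM _ _ yr zr; move/le_trans; apply.
apply: (@le_trans _ _ ((M + 1) * `|y - z|)).
  by rewrite ler_wpM2r// lerDl.
rewrite -ler_pdivlMl ?ltr_wpDl// mulrC; near: z.
by apply: cvgr_dist_le => //; rewrite divr_gt0// ltr_wpDl.
Unshelve. all: by end_near. Qed.

(** The mean value theorem on the segment from z to y, which lies in the ball by
    convexity. *)
Lemma smooth_bounded_lipschitz g : smooth g -> bounded_lipschitz g.
Proof.
have [r0|r_ge0] := ltP r 0.
  move=> _; exists 0 => // y z yr; move: (lt_le_trans r0 (normr_ge0 (y - x))).
  by rewrite ltNge yr.
have bounded (p : 'rV[R]_N -> R) : continuous p ->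
    exists2 M, 0 <= M & forall y, `|y - x| <= r -> `|p y| <= M.
  move=> cp; pose A := [set y | `|y - x| <= r].
  have A0 : A !=set0 by exists x; rewrite /A/= subrr normr0.
  have [|c _ cmax] := EVT_max_rV (f := fun y => `|p y|) A0
    (@norm_ball_compact _ _ x r).
    apply: continuous_subspaceT => y.
    apply: (@continuous_comp _ _ _ p Num.norm); first exact: cp.
    exact: norm_continuous.
  by exists `|p c| => // y yr; apply: cmax; rewrite inE.
move=> sg.
have [M0 M00 gM0] := bounded g (smooth_continuous sg).
have /choice[M HM] (j : 'I_N) : exists M, 0 <= M /\
    forall y, `|y - x| <= r -> `|partial j g y| <= M.
  have [M1 ? ?] := bounded _ (smooth_continuous (smooth_partial j sg)).
  by exists M1.
have SM : 0 <= \sum_j M j by rewrite sumr_ge0// => j _; have [] := HM j.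
exists (M0 + \sum_j M j); first exact: addr_ge0.
move=> y z yr zr; split; first by rewrite (le_trans (gM0 _ yr))// lerDl.
apply: (@le_trans _ _ ((\sum_j M j) * `|y - z|)); last first.
  by rewrite ler_wpM2r// lerDr.
have dline (t : R) :=
  is_derive_along (smooth_differentiable (z + t *: (y - z)) sg)
    (is_derive_line z (y - z) t).
have := @is_derive_norm_le _ (fun t => g (z + t *: (y - z)) - g z)
  (fun t => (\sum_j M j) * `|y - z| * t)
  (fun t => dot (grad g (z + t *: (y - z))) (y - z) - 0)
  (fun=> (\sum_j M j) * `|y - z|) 0 1.
rewrite scale1r scale0r addr0 !subrr normr0 mulr0 mulr1 (addrC z) subrK.
apply => //.
- apply: continuous_subspaceT => t; apply: cvgB; last exact: cvg_cst.
  apply: (@continuous_comp _ _ _ (fun t : R => z + t *: (y - z)) g).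
    exact: line_continuous.
  exact: smooth_continuous.
- apply: continuous_subspaceT => t.
  by apply: cvgM; [exact: cvg_cst|exact: cvg_id].
- by move=> t _; apply: is_derive_eq; rewrite /GRing.scale/=; ring.
move=> t /andP[/ltW t0 /ltW t1]; rewrite subr0 /dot mulr_suml.
rewrite (le_trans (ler_norm_sum _ _ _))//; apply: ler_sum => j _.
rewrite normrM ler_pM// ?row_norm_ge// mxE; have [_] := HM j; apply.
rewrite (_ : _ - x = t *: (y - x) + (1 - t) *: (z - x)); last first.
  by apply/rowP => i; rewrite !mxE; ring.
rewrite (le_trans (ler_normD _ _))// !normrZ (ger0_norm t0) ger0_norm ?subr_ge0//.
rewrite (@le_trans _ _ (t * r + (1 - t) * r))//; last by lra.
by rewrite lerD// ler_wpM2l// subr_ge0.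
Qed.

End BoundedLipschitz.

(** * The projected gradient field *)

Section ProjectedGradient.
Context {R : realType} {N : nat}.
Implicit Types (f h : 'rV[R]_N -> R) (x y : 'rV[R]_N).

Definition tangential_grad f h x : 'rV[R]_N :=
  grad f x -
  (dot (grad f x) (grad h x) / dot (grad h x) (grad h x)) *: grad h x.

Lemma PsiE f h x : Psi f h x = - (h x *: grad h x) - tangential_grad f h x.
Proof.
rewrite /Psi /tensor /tangential_grad mulmxBr mulmx1 mulmxA /unit_normal.
set g := grad h x; set c := (enorm g)^-1.
rewrite -scalemxAr mulmx_tr_dot mul_scalar_mx dotZr scalerA.
suff -> : c * (c * dot (grad f x) g) = dot (grad f x) g / dot g g by [].
by rewrite -enorm_sqr -exprVn -/c; ring.
Qed.

Lemma dot_grad_tangential f h x : grad h x <> 0 ->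
  dot (grad h x) (tangential_grad f h x) = 0.
Proof.
move=> /dot_gt0 g0; rewrite dotDr dotNr dotZr divfK ?gt_eqF//.
by rewrite dotC subrr.
Qed.

Lemma dot_gradf_tangential f h x : grad h x <> 0 ->
  dot (grad f x) (tangential_grad f h x) =
  dot (tangential_grad f h x) (tangential_grad f h x).
Proof.
move=> g0; rewrite [in RHS]/tangential_grad dotDl dotNl dotZl.
rewrite -/(tangential_grad f h x).
by rewrite dot_grad_tangential// mulr0 subr0.
Qed.

Lemma dot_gradh_Psi f h x : grad h x <> 0 ->
  dot (grad h x) (Psi f h x) = - (dot (grad h x) (grad h x)) * h x.
Proof.
move=> g0; rewrite PsiE dotDr !dotNr dotZr dot_grad_tangential//.
by rewrite subr0 mulNr mulrC.
Qed.

Lemma dot_gradf_Psi f h x : grad h x <> 0 ->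
  dot (grad f x) (Psi f h x) = - (h x * dot (grad f x) (grad h x)) -
    dot (tangential_grad f h x) (tangential_grad f h x).
Proof.
by move=> g0; rewrite PsiE dotDr !dotNr dotZr dot_gradf_tangential.
Qed.

Lemma Psi_eq0 f h x : grad h x <> 0 ->
  Psi f h x = 0 <-> h x = 0 /\ tangential_grad f h x = 0.
Proof.
move=> g0; split=> [Psi0|[hx w0]]; last first.
  by rewrite PsiE hx w0 scale0r subr0 oppr0.
have hx : h x = 0.
  have /eqP := dot_gradh_Psi f g0; rewrite Psi0 -(scale0r 0) dotZr mul0r.
  rewrite eq_sym mulNr oppr_eq0 mulf_eq0 gt_eqF ?dot_gt0//= => /eqP //.
split=> //; have := PsiE f h x.
by rewrite Psi0 hx scale0r oppr0 sub0r => /esym/eqP; rewrite oppr_eq0 => /eqP.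
Qed.

Lemma bounded_lipschitz_grad x r f j : smooth f ->
  bounded_lipschitz x r (fun y => grad f y 0 j).
Proof.
move=> sf; apply: eq_bounded_lipschitz
  (smooth_bounded_lipschitz x r (smooth_partial j sf)).
by move=> y; rewrite mxE.
Qed.

Lemma bounded_lipschitz_tangential x r (c : R) f h j : smooth f -> smooth h ->
  0 < c -> (forall y, `|y - x| <= r -> c <= dot (grad h y) (grad h y)) ->
  bounded_lipschitz x r (fun y => tangential_grad f h y 0 j).
Proof.
move=> sf sh c0 cg.
have bf i := bounded_lipschitz_grad x r i sf.
have bh i := bounded_lipschitz_grad x r i sh.
have := bounded_lipschitzD (bf j) (bounded_lipschitzN (bounded_lipschitzM
  (bounded_lipschitzM (bounded_lipschitz_dot bf bh)
    (bounded_lipschitzV c0 cg (bounded_lipschitz_dot bh bh))) (bh j))).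
by apply: eq_bounded_lipschitz => y; rewrite !mxE.
Qed.

Lemma bounded_lipschitz_Psi x r (c : R) f h j : smooth f -> smooth h ->
  0 < c -> (forall y, `|y - x| <= r -> c <= dot (grad h y) (grad h y)) ->
  bounded_lipschitz x r (fun y => Psi f h y 0 j).
Proof.
move=> sf sh c0 cg.
have := bounded_lipschitzD
  (bounded_lipschitzN (bounded_lipschitzM (smooth_bounded_lipschitz x r sh)
    (bounded_lipschitz_grad x r j sh)))
  (bounded_lipschitzN (bounded_lipschitz_tangential j sf sh c0 cg)).
by apply: eq_bounded_lipschitz => y; rewrite PsiE !mxE.
Qed.

End ProjectedGradient.

(** * Scalar equations u' = - q u *)

Section LinearDecay.
Context {R : realType}.
Variables (u q : R -> R) (a b : R).
Hypothesis u_continuous : {within `[a, b], continuous u}.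
Hypothesis u_decay : forall t, a < t < b -> is_derive t 1 u (- q t * u t).
Hypothesis q_ge0 : forall t, a < t < b -> 0 <= q t.

Lemma decay_sqr_le s t : a <= s -> s <= t -> t <= b -> u t ^+ 2 <= u s ^+ 2.
Proof.
move=> sa st tb; rewrite -[leRHS]addr0 -(mul0r (t - s)).
have itv r : s < r < t -> a < r < b.
  by move=> /andP[sr rt]; rewrite (le_lt_trans sa sr) (lt_le_trans rt tb).
apply: (@is_derive_increment_le _ (fun r => u r ^+ 2)
  (fun r => - q r * 2 * u r ^+ 2)) => //.
- apply: (@within_continuous_comp _ _ _ _ u (fun y => y ^+ 2)).
    by move=> y _; exact: exprn_continuous.
  apply: continuous_subspaceW u_continuous.
  by apply: subset_itv; rewrite bnd_simp.
- move=> r /itv/u_decay dr; apply: is_derive_eq.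
  by rewrite /GRing.scale /=; ring.
- move=> r /itv/q_ge0 q0; rewrite !mulNr oppr_le0.
  by rewrite mulr_ge0 ?sqr_ge0// mulr_ge0.
Qed.

Lemma decay_eq0 t : u a = 0 -> a <= t -> t <= b -> u t = 0.
Proof.
move=> ua0 ta tb; have := decay_sqr_le (lexx a) ta tb.
rewrite ua0 expr0n /= => u2; apply/eqP; rewrite -sqrf_eq0.
by rewrite eq_le u2 sqr_ge0.
Qed.

(** To become negative u has to vanish first, and from then on u^2 cannot
    grow. *)
Lemma decay_ge0 t : 0 <= u a -> a <= t -> t <= b -> 0 <= u t.
Proof.
move=> ua0 ta tb; rewrite leNgt; apply/negP => ut0.
have [s] : exists2 s, s \in `[a, t] & u s = 0.
  apply: IVT => //.
    apply: continuous_subspaceW u_continuous.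
    by apply: subset_itvl; rewrite bnd_simp.
  by rewrite ge_min le_max (ltW ut0) ua0 orbT.
rewrite in_itv /= => /andP[sa st] us0.
have := decay_sqr_le sa st tb; rewrite us0 expr0n /=.
by rewrite leNgt exprn_even_gt0//= lt_eqF.
Qed.

End LinearDecay.

(** * The exact penalty near a local solution *)

Section Penalty.
Context {R : realType} {N : nat}.
Variables (f h : 'rV[R]_N -> R) (x : 'rV[R]_N).
Hypothesis f_smooth : smooth f.
Hypothesis h_smooth : smooth h.
Hypothesis hx : h x = 0.
Hypothesis grad_hx : grad h x <> 0.

Lemma near_norm_ball (P : set 'rV[R]_N) : (\forall y \near x, P y) ->
  exists2 r, 0 < r & forall y, `|y - x| <= r -> P y.
Proof.
move=> /nbhs_ballP[e /= e0 eP]; exists (e / 2); first by rewrite divr_gt0.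
move=> y ye; apply: eP; rewrite -ball_normE /= distrC.
by rewrite (le_lt_trans ye)// ltr_pdivrMr// ltr_pMr// ltr1n.
Qed.

Lemma grad_dot_continuous g (v : 'rV[R]_N -> 'rV[R]_N) : smooth g ->
  (forall j, continuous (fun y => v y 0 j)) ->
  continuous (fun y => dot (grad g y) (v y)).
Proof.
move=> sg cv; have cg j : continuous (fun z => grad g z 0 j).
  have -> : (fun z => grad g z 0 j) = partial j g.
    by apply/funext => z; rewrite mxE.
  exact: (smooth_continuous (smooth_partial j sg)).
rewrite /dot; apply: (@continuous_big R _ +%R 0 xpredT _) => [z|j _ z].
  by apply: cvgD; [exact: cvg_fst|exact: cvg_snd].
exact: (cvgM (cg j z) (cv j z)).
Qed.

(** Near x the function h grows at least at rate c in the fixed direction v of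
    its gradient at x, so that h vanishes at a point of the segment from
    y - s v to y + s v, where s = |h y| / c. *)
Lemma near_level_projection : exists2 C, 0 <= C & forall rho, 0 < rho ->
  \forall y \near x, exists z, [/\ h z = 0, `|z - x| < rho &
    `|y - z| <= C * `|h y|].
Proof.
pose v := grad h x; pose c := dot v v / 2.
have c0 : 0 < c by rewrite divr_gt0// dot_gt0.
have ch : continuous h by exact: smooth_continuous.
have [e e0 ec] : exists2 e, 0 < e &
    forall w, `|w - x| <= e -> c <= dot (grad h w) v.
  apply: near_norm_ball.
  have /cvgr_ge : dot (grad h w) v @[w --> x] --> dot v v.
    apply: (@grad_dot_continuous h (fun=> v)) => // j.
    by move=> ?; exact: cst_continuous.
  by apply; rewrite /c ltr_pdivrMr// ltr_pMr ?ltr1n ?dot_gt0.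
exists (`|v| / c) => [|rho rho0]; first by rewrite divr_ge0// ltW.
pose e' := Num.min e (rho / 2).
have e'0 : 0 < e' by rewrite lt_min e0 divr_gt0.
have e'2 : 0 < e' / 2 by rewrite divr_gt0.
have near1 : \forall y \near x, `|y - x| < e' / 2.
  by apply/nbhs_ballP; exists (e' / 2) => // y; rewrite -ball_normE /= distrC.
have near2 : \forall y \near x, `|v| / c * `|h y| < e' / 2.
  have /cvgr_lt : `|v| / c * `|h y| @[y --> x] --> `|v| / c * `|h x|.
    exact: (cvgM (cvg_cst _) (cvg_norm (ch x))).
  by apply; rewrite hx normr0 mulr0.
apply: filterS2 near1 near2 => y yx yh.
pose s := `|h y| / c.
have s0 : 0 <= s by rewrite divr_ge0// ltW.
have zE (t : R) : `|t| <= s -> `|y + t *: v - x| <= e'.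
  move=> ts; rewrite addrAC (le_trans (ler_normD _ _))// (splitr e') lerD ?ltW//.
  rewrite (le_lt_trans _ yh)// normrZ (@le_trans _ _ (s * `|v|)) ?ler_wpM2r//.
  by rewrite /s le_eqVlt; apply/orP; left; apply/eqP; field; rewrite gt_eqF.
have cu : continuous (fun t : R => h (y + t *: v)).
  move=> t; apply: (@continuous_comp _ _ _ (fun t : R => y + t *: v) h).
    exact: line_continuous.
  exact: ch.
have increase (a b : R) : a <= b -> - s <= a -> b <= s ->
    h (y + a *: v) + c * (b - a) <= h (y + b *: v).
  move=> ab sa bs.
  suff : - h (y + b *: v) <= - h (y + a *: v) + - c * (b - a) by lra.
  apply: (@is_derive_increment_le _ (fun t => - h (y + t *: v))
    (fun t => - dot (grad h (y + t *: v)) v)) => //.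
  - by apply: continuous_subspaceT => t; apply: cvgN; exact: cu.
  - move=> t _; apply: is_deriveN; apply: is_derive_along.
      exact: smooth_differentiable.
    exact: is_derive_line.
  - move=> t /andP[at_ tb]; rewrite lerN2 ec// (@le_trans _ _ e')//.
      by apply: zE; rewrite ler_norml; apply/andP; split; lra.
    by rewrite ge_min lexx.
have sE : c * s = `|h y| by rewrite /s mulrC divfK// gt_eqF.
have hs : 0 <= h (y + s *: v).
  have := increase 0 s s0; rewrite scale0r addr0 subr0 sE => /(_ _ (lexx _)).
  by have := ler_norm (- h y); rewrite normrN oppr_le0 => ? /(_ s0); lra.
have hNs : h (y + (- s) *: v) <= 0.
  have := increase (- s) 0; rewrite scale0r addr0 sub0r opprK sE oppr_le0.
  by have := ler_norm (h y); move=> ? /(_ s0 (lexx _) s0); lra.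
have [t] : exists2 t, t \in `[- s, s] & h (y + t *: v) = 0.
  apply: IVT; first by lra.
    exact: continuous_subspaceT.
  by rewrite ge_min le_max hNs hs orbT.
rewrite in_itv /= -ler_norml => ts ht; exists (y + t *: v); split=> //.
  rewrite (le_lt_trans (zE _ ts))// (@le_lt_trans _ _ (rho / 2))//.
    by rewrite ge_min lexx orbT.
  by rewrite ltr_pdivrMr// ltr_pMr// ltr1n.
rewrite opprD addNKr normrN normrZ (@le_trans _ _ (s * `|v|)) ?ler_wpM2r//.
by rewrite /s le_eqVlt; apply/orP; left; apply/eqP; field; rewrite gt_eqF.
Qed.

(** A nearby feasible y with f y = f x would be another local solution, since
    f x <= f z for all feasible z near y. *)
Lemma strict_local_solution :
  [set y | local_solution f h y] `<=` isolated [set y | local_solution f h y] ->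
  local_solution f h x ->
  \forall y \near x, h y = 0 -> y <> x -> f x < f y.
Proof.
move=> iso xsol; have [_ [V Vx VE]] := iso _ xsol.
have [_ xmin] := xsol.
have := near_join xmin; move=> /= xmin2.
have nV : \forall y \near x, V y by exact: Vx.
apply: filterS3 nV xmin xmin2 => y Vy fxy fxz hy yx.
rewrite lt_neqAle fxy// andbT; apply/eqP => fE; apply: yx.
suff : (V `&` [set y | local_solution f h y]) y by rewrite VE.
split=> //; split=> //; apply: filterS fxz => z fz hz.
by rewrite -fE; exact: fz.
Qed.

(** Moving from y to a feasible z at distance C |h y| changes f by at most
    M C |h y|, which the penalty outweighs once K > M C. *)
Lemma exact_penalty :
  (\forall y \near x, h y = 0 -> y <> x -> f x < f y) ->
  exists K0, forall K, K0 < K ->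
    \forall y \near x, y <> x -> 0 < f y - f x + K * `|h y|.
Proof.
move=> fmin; have [C C0 proj] := near_level_projection.
have [M M0 fM] := smooth_bounded_lipschitz x 1 f_smooth.
have [e e0 eP] := near_norm_ball fmin.
have rho0 : 0 < Num.min e 1 by rewrite lt_min e0 ltr01.
exists (M * C) => K MCK.
have near1 : \forall y \near x, `|y - x| < 1.
  by apply/nbhs_ballP; exists 1 => //= y; rewrite -ball_normE /= distrC.
apply: filterS2 near1 (proj _ rho0) => y y1 [z [hz zx yz]] yx.
move: zx; rewrite lt_min => /andP[/ltW ze /ltW z1].
have fxz : f x <= f z.
  by have [->|/eqP zx] := eqVneq z x; rewrite // ltW// eP.
have [_ fyz] := fM _ _ (ltW y1) z1.
have fyz2 : f z - M * C * `|h y| <= f y.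
  have : `|f y - f z| <= M * C * `|h y|.
    by rewrite (le_trans fyz)// -mulrA ler_wpM2l.
  by rewrite ler_norml => /andP[? ?]; lra.
have [hy|hy] := eqVneq (h y) 0.
  have yE : y = z.
    by apply/eqP; rewrite -subr_eq0 -normr_le0; rewrite hy normr0 mulr0 in yz.
  have : f x < f z by apply: eP => //; rewrite -yE.
  by rewrite -yE hy normr0 mulr0; lra.
have : 0 < (K - M * C) * `|h y| by rewrite mulr_gt0 ?subr_gt0 ?normr_gt0.
by lra.
Qed.

(** If w were nonzero then, in the direction - w, the function f would decrease
    at rate |w|^2 while |h| = o(t), since w is orthogonal to the gradient of h;
    this contradicts the positivity of the penalty function. *)
Lemma lagrange_condition K :
  (\forall y \near x, 0 <= f y - f x + K * `|h y|) ->
  tangential_grad f h x = 0.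
Proof.
move=> Lge0; apply: contrapT => w0; pose w := tangential_grad f h x.
have S0 : 0 < dot w w by exact: dot_gt0.
have quotient g : smooth g ->
    t^-1 *: (g (t *: (- w) + x) - g x) @[t --> 0^'] --> dot (grad g x) (- w).
  move=> sg; rewrite -derive_grad; last exact: smooth_differentiable.
  by have := diff_derivable (v := - w) (smooth_differentiable x sg); exact.
have : t^-1 *: (f (t *: (- w) + x) - f x) +
    K * `|t^-1 *: (h (t *: (- w) + x) - h x)| @[t --> 0^'] -->
    dot (grad f x) (- w) + K * `|dot (grad h x) (- w)|.
  apply: cvgD; first exact: quotient.
  apply: cvgM; first exact: cvg_cst.
  by apply: cvg_norm; exact: quotient.
rewrite !dotNr (dot_grad_tangential f grad_hx) (dot_gradf_tangential f grad_hx).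
rewrite oppr0 normr0 mulr0 addr0.
move=> /cvg_dnbhs_at_right/cvgr_lt/(_ 0); rewrite oppr_lt0 => /(_ S0) neg.
have pos : \forall t \near 0^'+,
    0 <= f (t *: (- w) + x) - f x + K * `|h (t *: (- w) + x)|.
  have : (fun t : R => t *: (- w) + x) @ 0^'+ --> x.
    apply: cvg_at_right_filter.
    have := @line_continuous _ _ x (- w) 0; rewrite /continuous_at scale0r addr0.
    by under eq_fun do rewrite addrC.
  by move=> lim; exact: (lim _ Lge0).
near (0 : R)^'+ => t.
have t0 : 0 < t by near: t; exact: nbhs_right_gt.
have : t^-1 *: (f (t *: (- w) + x) - f x) +
    K * `|t^-1 *: (h (t *: (- w) + x) - h x)| < 0 by near: t.
rewrite hx subr0 normrZ (ger0_norm (_ : 0 <= t^-1)) ?invr_ge0 ?(ltW t0)//.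
rewrite /GRing.scale /= mulrCA -mulrDr pmulr_rlt0 ?invr_gt0// ltNge.
by move=> /negP; apply; near: t.
Unshelve. all: by end_near. Qed.

End Penalty.

(** * Stability along the flow *)

Section ConstrainedFlow.
Context {R : realType} {N : nat}.
Variables (f h : 'rV[R]_N -> R).
Hypothesis f_smooth : smooth f.
Hypothesis h_smooth : smooth h.
Implicit Types (gamma : R -> 'rV[R]_N) (x y : 'rV[R]_N).

Lemma flow_derive (g : 'rV[R]_N -> R) gamma (t : R) : smooth g ->
  is_derive t 1 gamma (Psi f h (gamma t)) ->
  is_derive t 1 (g \o gamma) (dot (grad g (gamma t)) (Psi f h (gamma t))).
Proof. by move=> sg; apply: is_derive_along; exact: smooth_differentiable. Qed.

Section Trajectory.
Variables (gamma : R -> 'rV[R]_N) (a b : R).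
Hypothesis gamma_continuous : {within `[a, b], continuous gamma}.
Hypothesis gamma_derive :
  forall t, a < t < b -> is_derive t 1 gamma (Psi f h (gamma t)).
Hypothesis grad_neq0 : forall t, a <= t <= b -> grad h (gamma t) <> 0.

Let q t := dot (grad h (gamma t)) (grad h (gamma t)).

Let grad_neq0' t : a < t < b -> grad h (gamma t) <> 0.
Proof. by move=> /andP[/ltW ta /ltW tb]; apply: grad_neq0; rewrite ta. Qed.

Lemma within_continuous_smooth (g : 'rV[R]_N -> R) : smooth g ->
  {within `[a, b], continuous (g \o gamma)}.
Proof.
move=> sg; apply: within_continuous_comp gamma_continuous => y _.
exact: smooth_continuous.
Qed.

(** The factor c will be 1 or -1, so that c h can be made nonnegative. *)
Lemma constraint_decay c : forall t, a < t < b ->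
  is_derive t 1 (fun s => c * h (gamma s)) (- q t * (c * h (gamma t))).
Proof.
move=> t tab; have := flow_derive h_smooth (gamma_derive tab).
rewrite dot_gradh_Psi; last exact: grad_neq0'.
move=> dh; apply: is_derive_eq; rewrite /GRing.scale /= /q; ring.
Qed.

Let constraint_continuous c :
  {within `[a, b], continuous (fun s => c * h (gamma s))}.
Proof.
move=> t; apply: cvgM; first exact: cvg_cst.
exact: (within_continuous_smooth h_smooth).
Qed.

Lemma constraint_ge0 c t : 0 <= c * h (gamma a) -> a <= t -> t <= b ->
  0 <= c * h (gamma t).
Proof.
apply: (decay_ge0 (u := fun s => c * h (gamma s)) (q := q)) => //.
- exact: constraint_decay.
- by move=> s _; exact: dot_ge0.
Qed.

Lemma constraint_eq0 t : h (gamma a) = 0 -> a <= t -> t <= b -> h (gamma t) = 0.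
Proof.
move=> ha at_ tb; rewrite -[LHS]mul1r.
apply: (decay_eq0 (u := fun s => 1 * h (gamma s)) (q := q)) at_ tb => //.
- exact: constraint_decay.
- by move=> s _; exact: dot_ge0.
- by rewrite ha mulr0.
Qed.

Lemma objective_le : h (gamma a) = 0 -> a <= b -> f (gamma b) <= f (gamma a).
Proof.
move=> ha ab; rewrite -[leRHS]addr0 -(mul0r (b - a)).
apply: (@is_derive_increment_le _ (f \o gamma)
  (fun t => dot (grad f (gamma t)) (Psi f h (gamma t)))) => //.
- exact: within_continuous_smooth.
- by move=> t tab; apply: flow_derive => //; exact: gamma_derive.
move=> t tab; rewrite dot_gradf_Psi; last exact: grad_neq0'.
have /andP[/ltW ta /ltW tb] := tab.
by rewrite constraint_eq0// mul0r oppr0 add0r oppr_le0 dot_ge0.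
Qed.

(** Minus the derivative of f + K |h| along the flow. *)
Definition dissipation K y := h y * dot (grad f y) (grad h y) +
  K * `|h y| * dot (grad h y) (grad h y) +
  dot (tangential_grad f h y) (tangential_grad f h y).

(** As h keeps its sign along the trajectory, |h| coincides there with c h for
    a constant c = 1 or c = -1, which is differentiable. *)
Lemma penalty_decrease x K d : a <= b ->
  (forall t, a <= t <= b -> d <= dissipation K (gamma t)) ->
  f (gamma b) - f x + K * `|h (gamma b)| <=
  f (gamma a) - f x + K * `|h (gamma a)| - d * (b - a).
Proof.
move=> ab dD.
have [c cE] : exists c, forall t, a <= t <= b ->
    c * h (gamma t) = `|h (gamma t)|.
  have [ha|/ltW ha] := leP 0 (h (gamma a)).
    exists 1 => t /andP[ta tb]; have := constraint_ge0 (c := 1) (t := t).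
    by rewrite !mul1r => ht; rewrite ger0_norm// ht.
  exists (- 1) => t /andP[ta tb]; have := constraint_ge0 (c := - 1) (t := t).
  by rewrite !mulN1r oppr_ge0 oppr_ge0 => ht; rewrite ler0_norm// ht.
suff : f (gamma b) + K * (c * h (gamma b)) <=
    f (gamma a) + K * (c * h (gamma a)) + - d * (b - a).
  by rewrite !cE ?lexx ?ab//; lra.
apply: (@is_derive_increment_le _ (fun t => f (gamma t) + K * (c * h (gamma t)))
  (fun t => dot (grad f (gamma t)) (Psi f h (gamma t)) +
            K * (- q t * (c * h (gamma t))))) => //.
- move=> t; apply: cvgD; first exact: (within_continuous_smooth f_smooth).
  by apply: cvgM; [exact: cvg_cst|exact: constraint_continuous].
- move=> t tab; have df := flow_derive f_smooth (gamma_derive tab).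
  have dh := constraint_decay c tab.
  by apply: is_deriveD.
- move=> t tab; have /andP[/ltW ta /ltW tb] := tab.
  have tab' : a <= t <= b by rewrite ta.
  have := dD t tab'; rewrite /dissipation -(cE t tab').
  rewrite dot_gradf_Psi; last exact: grad_neq0.
  by rewrite /q; lra.
Qed.

End Trajectory.

Variable U : set 'rV[R]_N.
Hypothesis U_open : open U.
Hypothesis grad_h_neq0_U : forall x, U x -> grad h x <> 0.

(** The trajectory from a nearby feasible y stays feasible, does not increase f
    and tends to x. *)
Lemma asymptotically_stable_local_solution x :
  asymptotically_stable_equilibrium U (Psi f h) x -> local_solution f h x.
Proof.
move=> [[Ux Psix] _ attr].
have [hx _] := (Psi_eq0 f (grad_h_neq0_U Ux)).1 Psix; split=> //.
apply: filterS attr => y [[gamma sol g0] lim] hy.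
have fcvg : f (gamma t) @[t --> +oo] --> f x.
  apply: (cvg_comp _ _ (lim _ sol g0)).
  exact: smooth_continuous.
rewrite -(cvg_lim _ fcvg)//; apply: limr_le; first by apply/cvg_ex; exists (f x).
near=> t; have t0 : 0 <= t by near: t; exact: nbhs_pinfty_ge (num_real 0).
case: sol => cg gU dg; rewrite -g0.
apply: (@objective_le _ 0 t) => //.
- apply: continuous_subspaceW cg => s /=.
  by rewrite in_itv /= => /andP[-> _]; split=> //; exact: ltry.
- by move=> s /andP[s0 _]; apply: dg; rewrite ?ltry.
- by move=> s /andP[s0 _]; apply: grad_h_neq0_U; apply: gU; rewrite ?ltry.
- by rewrite g0.
Unshelve. all: by end_near. Qed.

Hypothesis equilibria_isolated :
  [set x | equilibrium U (Psi f h) x] `<=`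
  isolated [set x | equilibrium U (Psi f h) x].
Hypothesis local_solutions_isolated :
  [set x | local_solution f h x] `<=`
  isolated [set x | local_solution f h x].

(** K exceeds both the threshold of [exact_penalty] and the ratio of
    |<grad f, grad h>| to |grad h|^2 near x, so that the term K |h| |grad h|^2
    of the dissipation dominates the only term of unknown sign. *)
Lemma local_solution_asymptotically_stable x : U x ->
  local_solution f h x -> asymptotically_stable_equilibrium U (Psi f h) x.
Proof.
move=> Ux xsol; have [hx _] := xsol; have gx := grad_h_neq0_U Ux.
have [K0 K0P] := exact_penalty f_smooth h_smooth hx gx
  (strict_local_solution local_solutions_isolated xsol).
pose S y := dot (grad h y) (grad h y); pose c := S x / 2.
have Sx0 : 0 < S x by exact: dot_gt0.
have c0 : 0 < c by rewrite divr_gt0.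
have bf j := bounded_lipschitz_grad x 1 j f_smooth.
have bh j := bounded_lipschitz_grad x 1 j h_smooth.
have [M M0 fgM] := bounded_lipschitz_dot bf bh.
pose K := Num.max K0 (M / c) + 1.
have K0K : K0 < K by rewrite ltr_pwDr// le_max lexx.
have McK : M / c < K by rewrite ltr_pwDr// le_max lexx orbT.
have K_gt0 : 0 < K by rewrite (le_lt_trans _ McK)// divr_ge0// ltW.
pose L y := f y - f x + K * `|h y|.
have Lx : L x = 0 by rewrite /L hx normr0 mulr0 subrr addr0.
have L_near : \forall y \near x, y <> x -> 0 < L y by exact: K0P.
have wx : tangential_grad f h x = 0.
  apply: (@lagrange_condition _ _ _ _ _ f_smooth h_smooth hx gx K).
  apply: filterS L_near => y Ly; have [->|/eqP/Ly/ltW//] := eqVneq y x.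
  by rewrite -/(L x) Lx.
have Psix : Psi f h x = 0 by apply/Psi_eq0.
have [_ [V Vx VE]] := equilibria_isolated (conj Ux Psix).
have V_near : \forall y \near x, V y by exact: Vx.
have U_near : \forall y \near x, U y by exact: open_nbhs_nbhs.
have one_near : \forall y \near x, `|y - x| <= 1.
  by apply/nbhs_ballP; exists 1 => //= y; rewrite -ball_normE /= distrC => /ltW.
have S_near : \forall y \near x, c <= S y.
  have /cvgr_ge : S y @[y --> x] --> S x.
    apply: (@grad_dot_continuous _ _ h (grad h)) => // j.
    have -> : (fun y => grad h y 0 j) = partial j h.
      by apply/funext => y; rewrite mxE.
    exact: (smooth_continuous (smooth_partial j h_smooth)).
  by apply; rewrite /c ltr_pdivrMr// ltr_pMr ?ltr1n.
have [r r0 rP] : exists2 r, 0 < r & forall y, `|y - x| <= r ->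
    [/\ y <> x -> 0 < L y, V y, U y, `|y - x| <= 1 & c <= S y].
  apply: near_norm_ball; near=> y; split; near: y => //.
pose D := dissipation K.
have D_gt0 y : `|y - x| <= r -> y <> x -> 0 < D y.
  move=> /rP[_ Vy Uy y1 cS] yx.
  have ww := dot_ge0 (tangential_grad f h y).
  have [hy|hy] := eqVneq (h y) 0.
    rewrite /D /dissipation hy normr0 mulr0 !mul0r !add0r; apply: dot_gt0 => wy.
    apply: yx; suff : (V `&` [set x | equilibrium U (Psi f h) x]) y by rewrite VE.
    split; first exact: Vy.
    by split; [exact: Uy|apply/(Psi_eq0 f (grad_h_neq0_U Uy))].
  have [fgy _] := fgM _ _ y1 y1.
  have KS : M < K * S y.
    have MKc : M < K * c by rewrite -ltr_pdivrMr.
    by apply: lt_le_trans MKc _; rewrite ler_wpM2l// ltW.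
  have hfg : - (`|h y| * M) <= h y * dot (grad f y) (grad h y).
    rewrite lerNl (le_trans (ler_norm _))// normrN normrM ler_wpM2l//.
  have : 0 < `|h y| * (K * S y - M) by rewrite mulr_gt0 ?normr_gt0 ?subr_gt0.
  rewrite /D /dissipation -/(S y) (mulrC K) -mulrA; lra.
have Sr y : `|y - x| <= r -> c <= S y by move=> /rP[].
have [k kP] := bounded_lipschitz_row
  (fun j => bounded_lipschitz_Psi j f_smooth h_smooth c0 Sr).
apply: (@lyapunov_asymptotically_stable _ _ U (Psi f h) x L D r k) => //.
- by move=> y /rP[].
- move=> y; exact: (cvgD
    (cvgB (smooth_continuous f_smooth (x := y)) (cvg_cst _))
    (cvgM (cvg_cst _) (cvg_norm (smooth_continuous h_smooth (x := y))))).
- by move=> y /rP[].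
- apply: bounded_lipschitz_within_continuous.
  have bfr j := bounded_lipschitz_grad x r j f_smooth.
  have bhr j := bounded_lipschitz_grad x r j h_smooth.
  have bwr j := bounded_lipschitz_tangential j f_smooth h_smooth c0 Sr.
  have hr := smooth_bounded_lipschitz x r h_smooth.
  apply: bounded_lipschitzD; last exact: bounded_lipschitz_dot.
  apply: bounded_lipschitzD.
    by apply: bounded_lipschitzM => //; exact: bounded_lipschitz_dot.
  apply: bounded_lipschitzM; last exact: bounded_lipschitz_dot.
  apply: bounded_lipschitzM; first exact: bounded_lipschitz_cst.
  exact: bounded_lipschitz_norm.
- rewrite /D /dissipation wx hx normr0 mulr0 !mul0r !add0r.
  by rewrite -(scale0r 0) dotZr mul0r.
- move=> gamma a b d ab cg gr dg dD; apply: penalty_decrease => //.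
  by move=> t /gr/rP[_ _ /grad_h_neq0_U].
Unshelve. all: by end_near. Qed.

End ConstrainedFlow.

Theorem proposition1p2 (R : realType) (N : nat) (f h : 'rV[R]_N -> R)
    (U : set 'rV[R]_N)
    (f_smooth : smooth f) (h_smooth : smooth h)
    (grad_h_neq0 : forall x, h x = 0 -> grad h x <> 0)
    (U_open : open U)
    (U_nbhd : [set x | h x = 0] `<=` U)
    (grad_h_neq0_U : forall x, U x -> grad h x <> 0)
    (equilibria_isolated :
       [set x | equilibrium U (Psi f h) x] `<=`
       isolated [set x | equilibrium U (Psi f h) x])
    (local_solutions_isolated :
       [set x | local_solution f h x] `<=`
       isolated [set x | local_solution f h x]) :
  [set x | asymptotically_stable_equilibrium U (Psi f h) x] =
  [set x | local_solution f h x].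
Proof.
apply/seteqP; split => x /=.
  exact: asymptotically_stable_local_solution.
move=> xsol; apply: local_solution_asymptotically_stable => //.
by apply: U_nbhd; case: xsol.
Qed.
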